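(* Let $R$ be a commutative ring with identity, let $\mathcal{M}=(M_n,f_n)_{n\ge 0}$ and $\mathcal{M}'=(M'_n,f'_n)_{n\ge 0}$ be complexes of $R$-modules, and let $\phi=\{\phi_n:M_n\to M'_n\}_{n\ge 0}:\mathcal{M}\to\mathcal{M}'$ be a map of complexes of $R$-modules. Then $\phi$ induces a sequence $$\{H_n(\mathcal{R}(\phi)):H_n(\mathcal{R}(\mathcal{M}))\to H_n(\mathcal{R}(\mathcal{M}'))\}_{n\ge 0}$$ of $\mathcal{R}(R)$-semimodule homomorphisms such that for each $N\in Z_n(\mathcal{R}(\mathcal{M}))$, $$H_n(\mathcal{R}(\phi))\bigl(N/B_n(\mathcal{R}(\mathcal{M}))\bigr)=\mathcal{R}(\phi_n)(N)/B_n(\mathcal{R}(\mathcal{M}'))=\operatorname{rad}(\phi_n(N))/B_n(\mathcal{R}(\mathcal{M}')).$$ Moreover: (1) For the identity map $I_{\mathcal{M}}:\mathcal{M}\to\mathcal{M}$ of complexes of $R$-modules, $H_n(\mathcal{R}(I_{\mathcal{M}}))=I_{H_n(\mathcal{R}(\mathcal{M}))}$ (the identity map on $H_n(\mathcal{R}(\mathcal{M}))$) for all $n\ge 0$. (2) For any two maps $\phi:\mathcal{M}\to\mathcal{M}'$ and $\psi:\mathcal{M}'\to\mathcal{M}''$ of complexes of $R$-modules, $H_n(\mathcal{R}(\psi))\,H_n(\mathcal{R}(\phi))=H_n(\mathcal{R}(\psi\phi))$ for all $n\ge 0$.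
   Context: For an $R$-module $M$ and a submodule $N\subseteq M$, $\operatorname{rad}(N)$ is the intersection of all prime submodules of $M$ containing $N$ (and $\operatorname{rad}(N)=M$ if there is none); a submodule $P\subsetneq M$ is prime if $rm\in P$ ($r\in R$, $m\in M$) implies $m\in P$ or $rM\subseteq P$. $N$ is a radical submodule if $\operatorname{rad}(N)=N$. For an ideal $I$ of $R$, $\sqrt I$ is its usual radical. $\mathcal{R}(R)$ is the set of radical ideals of $R$, a commutative semiring with sum $\sqrt{I+J}$ and product $\sqrt{IJ}$. $\mathcal{R}(M)$ is the set of radical submodules of $M$, an $\mathcal{R}(R)$-semimodule with addition $\operatorname{rad}(N+L)$ and scalar action $\operatorname{rad}(IN)$; its zero element is $\operatorname{rad}(0)$. (A semimodule over a commutative semiring is a commutative monoid with an action satisfying the usual unital module axioms, with $r0=0$ and $0m=0$.) For an $R$-module homomorphism $f:M\to M'$, $\mathcal{R}(f):\mathcal{R}(M)\to\mathcal{R}(M')$ is the $\mathcal{R}(R)$-semimodule homomorphism $\mathcal{R}(f)(N)=\operatorname{rad}(f(N))$. It is known that $\mathcal{R}$ is a covariant functor from $R$-modules to $\mathcal{R}(R)$-semimodules. A complex $\mathcal{M}=(M_n,f_n)_{n\ge 0}$ of $R$-modules is a sequence of modules with homomorphisms $f_n:M_n\to M_{n-1}$ ($M_{-1}=0$) and $f_nf_{n+1}=0$ for all $n\geq 0$. A map of complexes $\phi:\mathcal{M}\to\mathcal{M}'$ is a family of homomorphisms $\phi_n:M_n\to M'_n$ with $f'_n\phi_n=\phi_{n-1}f_n$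 for all $n\ge 1$. $\mathcal{R}(\mathcal{M})=(\mathcal{R}(M_n),\mathcal{R}(f_n))_{n\ge 0}$ is a complex of $\mathcal{R}(R)$-semimodules, with $n$-cycles $Z_n(\mathcal{R}(\mathcal{M}))=\operatorname{Ker}\mathcal{R}(f_n)$ (elements mapped to the zero element) and $n$-boundaries $B_n(\mathcal{R}(\mathcal{M}))=\operatorname{Im}\mathcal{R}(f_{n+1})\subseteq Z_n(\mathcal{R}(\mathcal{M}))$. For a subsemimodule $\mathsf{N}$ of a semimodule $\mathsf{M}$, the Bourne relation is $m\equiv_{\mathsf{N}}m'$ iff $m+n=m'+n'$ for some $n,n'\in\mathsf{N}$; the class of $m$ is $m/\mathsf{N}$, and the set of classes $\mathsf{M}/\mathsf{N}$ is a semimodule with the induced operations. The $n$-th radical homology is $H_n(\mathcal{R}(\mathcal{M}))=Z_n(\mathcal{R}(\mathcal{M}))/B_n(\mathcal{R}(\mathcal{M}))$. *)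

(* Defs.v *)
From HB Require Import structures.
From mathcomp Require Import all_boot all_order all_algebra.
From mathcomp Require Import generic_quotient.
From mathcomp Require Import boolp classical_sets.

Set Implicit Arguments.
Unset Strict Implicit.
Unset Printing Implicit Defensive.

Import GRing.Theory.
Local Open Scope classical_set_scope.
Local Open Scope ring_scope.
Local Open Scope quotient_scope.

(* [comPzRingType] is the structure of commutative rings with identity in which
   [1 = 0] is not excluded.  Ideals of [R] are submodules of [R^o], the ring [R]
   seen as a module over itself. *)

Section Submodules.
Variable R : comPzRingType.
Implicit Types M : lmodType R.

Definition submodule M (N : set M) : Prop := GRing.submod_closed (mem N).

Definition ideal (I : set R) : Prop := @submodule R^o I.

Definition sumset (V : nmodType) (A B : set V) : set V :=
  [set x + y | x in A & y in B].

(* The submodule [I N], generated by the products [r *: x]; for [M := R^o]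
   this is the product of ideals. *)
Definition mulset M (I : set R) (N : set M) : set M :=
  smallest (@submodule M) [set r *: x | r in I & x in N].

Definition idealM (I J : set R) : set R := @mulset R^o I J.

Definition prime_submodule M (P : set M) : Prop :=
  [/\ submodule P, P <> setT &
      forall (r : R) (m : M), P (r *: m) -> P m \/ (forall x : M, P (r *: x))].

(* An intersection over the empty family is [setT]. *)
Definition module_rad M (N : set M) : set M :=
  \bigcap_(P in [set P | prime_submodule P /\ N `<=` P]) P.

Definition radical_submodule M (N : set M) : Prop := submodule N /\ module_rad N = N.

(* [n = 0] is harmless: [I (x ^+ 0)] already means that [I] is the whole ring. *)
Definition ideal_sqrt (I : set R) : set R := [set x | exists n, I (x ^+ n)].

Definition radical_ideal (I : set R) : Prop := ideal I /\ ideal_sqrt I = I.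

Lemma submoduleP M (N : set M) :
  submodule N <-> [/\ N 0, forall x y, N x -> N y -> N (x + y) &
                      forall r x, N x -> N (r *: x)].
Proof.
split=> [[]|[N0 ND NZ]].
  move=> /set_mem N0 Nlin; split=> // [x y Nx Ny|r x Nx].
    by rewrite -[x]scale1r; apply/set_mem/Nlin; apply/mem_set.
  by rewrite -[r *: x]addr0; apply/set_mem/Nlin; apply/mem_set.
split; first exact/mem_set.
move=> r x y /set_mem Nx /set_mem Ny; apply/mem_set.
by apply: ND => //; apply: NZ.
Qed.

Lemma idealP (I : set R) :
  ideal I <-> [/\ I 0, forall x y, I x -> I y -> I (x + y) &
                  forall r x, I x -> I (r * x)].
Proof. exact: (@submoduleP R^o). Qed.

Lemma submodule0 M (N : set M) : submodule N -> N 0.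
Proof. by case/submoduleP. Qed.
Lemma submoduleD M (N : set M) : submodule N -> forall x y, N x -> N y -> N (x + y).
Proof. by case/submoduleP. Qed.
Lemma submoduleZ M (N : set M) : submodule N -> forall r x, N x -> N (r *: x).
Proof. by case/submoduleP. Qed.

Lemma submodule_set0 M : submodule [set 0 : M].
Proof.
by apply/submoduleP; split=> //= [x y -> ->|r x ->]; rewrite ?addr0 ?scaler0.
Qed.

Lemma submodule_setT M : submodule [set: M].
Proof. exact/submoduleP. Qed.

Lemma submodule_bigcap M (F : set (set M)) :
  (forall P, F P -> submodule P) -> submodule (\bigcap_(P in F) P).
Proof.
move=> FS; apply/submoduleP; split=> [P /FS/submodule0 //|x y Nx Ny P FP|r x Nx P FP].
  by apply: (submoduleD (FS _ FP)); [apply: Nx|apply: Ny].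
by apply: (submoduleZ (FS _ FP)); apply: Nx.
Qed.

Lemma submodule_sum M (A B : set M) :
  submodule A -> submodule B -> submodule (sumset A B).
Proof.
move=> sA sB; apply/submoduleP; split.
- by exists 0; [exact: submodule0|exists 0; [exact: submodule0|rewrite addr0]].
- move=> _ _ [a Aa [b Bb <-]] [c Ac [d Bd <-]].
  exists (a + c); first exact: submoduleD.
  by exists (b + d); [exact: submoduleD|rewrite addrACA].
- move=> r _ [a Aa [b Bb <-]].
  exists (r *: a); first exact: submoduleZ.
  by exists (r *: b); [exact: submoduleZ|rewrite scalerDr].
Qed.

Lemma submodule_mulset M (I : set R) (N : set M) : submodule (mulset I N).
Proof. by apply: submodule_bigcap => P []. Qed.

Lemma sumset_sub M (A B P : set M) : submodule P -> A 0 -> B 0 ->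
  (sumset A B `<=` P) <-> (A `<=` P /\ B `<=` P).
Proof.
move=> sP A0 B0; split=> [AB|[AP BP] _ [a Aa [b Bb <-]]].
  split=> x Px; apply: AB; first by exists x => //; exists 0 => //; rewrite addr0.
  by exists 0 => //; exists x => //; rewrite add0r.
by apply: (submoduleD sP); [apply: AP|apply: BP].
Qed.

Lemma mulset_sub M (I : set R) (N P : set M) : submodule P ->
  (mulset I N `<=` P) <-> (forall r x, I r -> N x -> P (r *: x)).
Proof.
move=> sP; split=> [INP r x Ir Nx|INP].
  by apply: INP; apply: sub_gen_smallest; exists r => //; exists x.
by apply: smallest_sub => // _ [r Ir [x Nx <-]]; apply: INP.
Qed.

Lemma submodule_rad M (N : set M) : submodule (module_rad N).
Proof. by apply: submodule_bigcap => P [[]]. Qed.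

Lemma sub_rad M (N : set M) : N `<=` module_rad N.
Proof. by move=> x Nx P [_]; apply. Qed.

Lemma rad_sub M (N P : set M) : prime_submodule P ->
  (module_rad N `<=` P) <-> (N `<=` P).
Proof.
by move=> pP; split=> [|NP x]; [exact: (subset_trans (@sub_rad M N))|exact].
Qed.

Lemma eq_rad M (A B : set M) :
  (forall P, prime_submodule P -> (A `<=` P) <-> (B `<=` P)) -> module_rad A = module_rad B.
Proof.
move=> AB; rewrite /module_rad; congr (bigcap _ _); apply/seteqP.
by split=> P [pP ?]; split=> //; apply/(AB _ pP).
Qed.

Lemma rad_id M (N : set M) : module_rad (module_rad N) = module_rad N.
Proof. by apply: eq_rad => P; apply: rad_sub. Qed.

Lemma radical_rad M (N : set M) : radical_submodule (module_rad N).
Proof. by split; [exact: submodule_rad|exact: rad_id]. Qed.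

Definition colon M (P : set M) : set R := [set r | forall x, P (r *: x)].

Lemma ideal_colon M (P : set M) : submodule P -> ideal (colon P).
Proof.
move=> sP; apply/idealP; split=> [x|r s Pr Ps x|r s Ps x].
- by rewrite scale0r; apply: submodule0.
- by rewrite scalerDl; apply: submoduleD.
- by rewrite -scalerA; apply: submoduleZ.
Qed.

Lemma prime_colon1 M (P : set M) : prime_submodule P -> ~ colon P 1.
Proof.
case=> _ PT _ P1; apply: PT; apply/seteqP; split=> // x _.
by rewrite -[x]scale1r; apply: P1.
Qed.

Lemma mulset_subP M (I : set R) (N P : set M) : prime_submodule P ->
  (mulset I N `<=` P) <-> (N `<=` P \/ I `<=` colon P).
Proof.
move=> [sP _ pP]; rewrite mulset_sub //; split=> [INP|[NP r x _ /NP|IP r x /IP]//].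
  apply: contrapT => /not_orP[/existsNP[x /not_implyP[Nx nPx]] nI].
  by apply: nI => r Ir; case: (pP _ _ (INP _ _ Ir Nx)).
exact: submoduleZ.
Qed.

Lemma sqrt_colon M (A : set R) (P : set M) : prime_submodule P ->
  (ideal_sqrt A `<=` colon P) <-> (A `<=` colon P).
Proof.
move=> pP; split=> [AP x Ax|AP x [n /AP]]; first by apply: AP; exists 1%N.
elim: n => [|n IHn]; first by rewrite expr0 => /(prime_colon1 pP).
move=> Pxn; case: (lem (colon P x)) => // ncx; apply: IHn => y.
by have := Pxn y; rewrite exprS -scalerA; case: pP => _ _ pP /pP[]// /ncx.
Qed.

Lemma idealM_sub (I J K : set R) : ideal K ->
  (idealM I J `<=` K) <-> (forall r s, I r -> J s -> K (r * s)).
Proof. exact: (@mulset_sub R^o). Qed.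

Lemma idealM_colon M (I J : set R) (P : set M) : prime_submodule P ->
  (idealM I J `<=` colon P) <-> (I `<=` colon P \/ J `<=` colon P).
Proof.
move=> pP; have [sP _ pP'] := pP.
rewrite (idealM_sub _ _ (ideal_colon sP)); split=> [IJ|].
  apply: contrapT => /not_orP[/existsNP[r /not_implyP[Ir ncr]] nJ].
  by apply: nJ => s Js x; have := IJ _ _ Ir Js x; rewrite -scalerA => /pP'[].
case=> [IP r s /IP rP _ x|JP r s _ /JP sP' x]; rewrite -scalerA; first exact: rP.
exact: submoduleZ.
Qed.

Lemma ideal_ideal_sqrt (I : set R) : ideal I -> ideal (ideal_sqrt I).
Proof.
move=> iI; have [I0 ID IM] := (iffLR (idealP I) iI); apply/idealP; split.
- by exists 1%N.
- move=> x y [m Im] [n In]; exists (m + n)%N; rewrite exprDn.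
  apply: big_ind => // i _; rewrite -mulr_natl; apply: (IM).
  move: (nat_of_ord i) => {}i.
  have [/subnK <-|/ltnW lin] := leqP n i; first by rewrite exprD mulrA; apply: IM.
  by rewrite mulrC -addnBA // addnC exprD !mulrA; apply: IM.
- by move=> r x [n In]; exists n; rewrite exprMn; apply: IM.
Qed.

Lemma ideal_set0 : ideal [set 0].
Proof. exact: (@submodule_set0 R^o). Qed.
Lemma ideal_setT : ideal [set: R].
Proof. exact: (@submodule_setT R^o). Qed.
Lemma ideal_sum (I J : set R) : ideal I -> ideal J -> ideal (sumset I J).
Proof. exact: (@submodule_sum R^o). Qed.
Lemma ideal_idealM (I J : set R) : ideal (idealM I J).
Proof. exact: (@submodule_mulset R^o). Qed.

Lemma sub_sqrt (I : set R) : I `<=` ideal_sqrt I.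
Proof. by move=> x Ix; exists 1%N. Qed.

Lemma sqrt_sub (A K : set R) : radical_ideal K ->
  (ideal_sqrt A `<=` K) <-> (A `<=` K).
Proof.
case=> _ rK; split=> [|AK x [n /AK Kxn]]; first exact: (subset_trans (@sub_sqrt A)).
by rewrite -rK; exists n.
Qed.

Lemma radical_sqrt (I : set R) : ideal I -> radical_ideal (ideal_sqrt I).
Proof.
move=> iI; split; first exact: ideal_ideal_sqrt.
apply/seteqP; split=> [x [m [n Ixmn]]|]; last exact: sub_sqrt.
by exists (m * n)%N; rewrite exprM.
Qed.

Definition colonI (K L : set R) : set R := [set r | forall l, L l -> K (r * l)].

Lemma radical_colonI (K L : set R) : radical_ideal K -> radical_ideal (colonI K L).
Proof.
case=> /idealP[K0 KD KM] rK; split.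
  apply/idealP; split=> [l _|x y Kx Ky l Ll|r x Kx l Ll].
  - by rewrite mul0r.
  - by rewrite mulrDl; apply: KD; [apply: Kx|apply: Ky].
  - by rewrite -mulrA; apply: KM; apply: Kx.
apply/seteqP; split=> [x [n Kxn] l Ll|]; last exact: sub_sqrt.
rewrite -rK; exists n.+1; rewrite exprMn (exprS x) (exprSr l) mulrACA.
by apply: KM; apply: Kxn.
Qed.

End Submodules.

Section RadicalIdeals.
Variable R : comPzRingType.

Record radIdeals := RadIdeal {
  radIdeal_set :> set R;
  _ : `[< radical_ideal radIdeal_set >]
}.

HB.instance Definition _ := [isSub for radIdeal_set].
HB.instance Definition _ := [Choice of radIdeals by <:].

Implicit Types I J K : radIdeals.

Lemma radIdealP I : radical_ideal I.
Proof. by case: I => I /= /asboolP. Qed.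

Lemma radIdeal_ideal I : ideal I. Proof. by case: (radIdealP I). Qed.

Definition sqrtI (I : set R) (iI : ideal I) : radIdeals :=
  RadIdeal (asboolT (radical_sqrt iI)).

Lemma eq_radIdeals I J :
  (forall K : set R, radical_ideal K -> (I `<=` K) <-> (J `<=` K)) -> I = J.
Proof.
move=> IJ; apply/val_inj/seteqP => /=.
by split; [apply/(IJ _ (radIdealP J))|apply/(IJ _ (radIdealP I))].
Qed.

Definition radI0 : radIdeals := sqrtI (ideal_set0 R).
Definition radI1 : radIdeals := sqrtI (ideal_setT R).
Definition radI_add I J : radIdeals :=
  sqrtI (ideal_sum (radIdeal_ideal I) (radIdeal_ideal J)).
Definition radI_mul I J : radIdeals := sqrtI (ideal_idealM I J).

Let ideal0 (K : set R) : ideal K -> K 0. Proof. by case/idealP. Qed.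

Let add_sub I J (K : set R) : radical_ideal K ->
  (radI_add I J `<=` K) <-> (I `<=` K /\ J `<=` K).
Proof.
move=> rK; have [iK _] := rK; rewrite /= sqrt_sub //.
by apply: (@sumset_sub _ R^o) => //; apply: ideal0; apply: radIdeal_ideal.
Qed.

Let mul_sub I J (K : set R) : radical_ideal K ->
  (radI_mul I J `<=` K) <-> (I `<=` colonI K J).
Proof.
move=> rK; have [iK _] := rK; rewrite /= sqrt_sub // idealM_sub //.
by split=> IJ r => [Ir s Js|s Ir Js]; apply: IJ.
Qed.

Let addA : associative radI_add.
Proof. by move=> I J L; apply: eq_radIdeals => K rK; rewrite !add_sub // and_assoc. Qed.
Let addC : commutative radI_add.
Proof. by move=> I J; apply: eq_radIdeals => K rK; rewrite !add_sub // and_comm. Qed.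
Let zero_sub (K : set R) : radical_ideal K -> radI0 `<=` K.
Proof. by move=> rK; apply/sqrt_sub => // _ ->; apply: ideal0; case: rK. Qed.
Let add0 : left_id radI0 radI_add.
Proof.
move=> I; apply: eq_radIdeals => K rK; rewrite add_sub //.
by split=> [[]//|IK]; split=> //; apply: zero_sub.
Qed.

HB.instance Definition _ := GRing.isNmodule.Build radIdeals addA addC add0.

Let mulC : commutative radI_mul.
Proof.
move=> I J; apply: eq_radIdeals => K rK; rewrite !mul_sub //.
by split=> IJ r Jr s Is; rewrite mulrC; apply: IJ.
Qed.
Let mulA : associative radI_mul.
Proof.
have mulrCCA (a b c : R) : a * b * c = c * b * a by rewrite mulrC [a * b]mulrC mulrA.
move=> I J L; rewrite (mulC I) (mulC J L); apply: eq_radIdeals => K rK.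
rewrite !mul_sub //; try exact: radical_colonI.
by split=> h i Ii j Jj l Ll; rewrite mulrCCA; apply: h.
Qed.
Let mul1 : left_id radI1 radI_mul.
Proof.
move=> I; apply: eq_radIdeals => K rK; rewrite mul_sub //.
have [/idealP[_ _ KM] _] := rK; split=> [IK x Ix|IK r _ x Ix]; last exact/KM/IK.
by rewrite -[x]mul1r; apply: IK => //; exists 1%N.
Qed.
Let mulDl : left_distributive radI_mul radI_add.
Proof.
move=> I J L; apply: eq_radIdeals => K rK; rewrite mul_sub // !add_sub //.
  by rewrite !mul_sub.
exact: radical_colonI.
Qed.
Let mul0 : left_zero radI0 radI_mul.
Proof.
move=> I; apply: eq_radIdeals => K rK; rewrite mul_sub //.
by split=> _; apply: zero_sub => //; apply: radical_colonI.
Qed.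

HB.instance Definition _ :=
  GRing.Nmodule_isComPzSemiRing.Build radIdeals mulA mulC mul1 mulDl mul0.

End RadicalIdeals.

Section RadicalSubmodules.
Variables (R : comPzRingType) (M : lmodType R).

Record radSubmods := RadSubmod {
  radSubmod_set :> set M;
  _ : `[< radical_submodule radSubmod_set >]
}.

HB.instance Definition _ := [isSub for radSubmod_set].
HB.instance Definition _ := [Choice of radSubmods by <:].

Implicit Types (N L : radSubmods) (I J : radIdeals R) (P : set M).

Definition radS (A : set M) : radSubmods := RadSubmod (asboolT (radical_rad A)).

Lemma radSubmodP N : radical_submodule N.
Proof. by case: N => N /= /asboolP. Qed.

Lemma radSubmod0 N : (N : set M) 0.
Proof. by apply: submodule0; case: (radSubmodP N). Qed.

Lemma eq_radSubmods N L :
  (forall P, prime_submodule P -> (N `<=` P) <-> (L `<=` P)) -> N = L.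
Proof.
move=> /eq_rad; case: (radSubmodP N) => _ ->; case: (radSubmodP L) => _ -> NL.
exact/val_inj.
Qed.

Definition radS_add N L : radSubmods := radS (sumset N L).
Definition radS_scale I N : radSubmods := radS (mulset I N).

Lemma radS0_sub P : prime_submodule P -> radS [set 0] `<=` P.
Proof. by move=> pP; apply/rad_sub => // _ ->; apply: submodule0; case: pP. Qed.

Lemma radS_add_sub N L P : prime_submodule P ->
  (radS_add N L `<=` P) <-> (N `<=` P /\ L `<=` P).
Proof.
move=> pP; have [sP _ _] := pP; rewrite /= rad_sub // sumset_sub //; exact: radSubmod0.
Qed.

Lemma radS_scale_sub I N P : prime_submodule P ->
  (radS_scale I N `<=` P) <-> (N `<=` P \/ I `<=` colon P).
Proof. by move=> pP; rewrite /= rad_sub // mulset_subP. Qed.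

Let addA : associative radS_add.
Proof. by move=> N L K; apply: eq_radSubmods => P pP; rewrite !radS_add_sub // and_assoc. Qed.
Let addC : commutative radS_add.
Proof. by move=> N L; apply: eq_radSubmods => P pP; rewrite !radS_add_sub // and_comm. Qed.
Let add0 : left_id (radS [set 0]) radS_add.
Proof.
move=> N; apply: eq_radSubmods => P pP; rewrite radS_add_sub //.
by split=> [[]//|NP]; split=> //; apply: radS0_sub.
Qed.

HB.instance Definition _ := GRing.isNmodule.Build radSubmods addA addC add0.

Let scaleA I J N : radS_scale I (radS_scale J N) = radS_scale (I * J) N.
Proof.
apply: eq_radSubmods => P pP; rewrite !radS_scale_sub // sqrt_colon //.
by rewrite idealM_colon //; tauto.
Qed.
Let scale0 N : radS_scale 0 N = 0.
Proof.
apply: eq_radSubmods => P pP; rewrite radS_scale_sub //.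
split=> _; first exact: radS0_sub.
by right; apply/sqrt_colon => // _ -> x; rewrite scale0r; apply: submodule0; case: pP.
Qed.
Let scale1 : left_id 1 radS_scale.
Proof.
move=> N; apply: eq_radSubmods => P pP; rewrite radS_scale_sub // sqrt_colon //.
by split=> [[//|/(_ 1 I) /(prime_colon1 pP)//]|]; left.
Qed.
Let scaleDr : right_distributive radS_scale +%R.
Proof.
move=> I N L; apply: eq_radSubmods => P pP.
by rewrite radS_scale_sub // !radS_add_sub // !radS_scale_sub //; tauto.
Qed.
Let scaleDl N : {morph radS_scale^~ N : I J / I + J}.
Proof.
move=> I J; apply: eq_radSubmods => P pP.
rewrite radS_scale_sub // !radS_add_sub // !radS_scale_sub // sqrt_colon //.
rewrite (@sumset_sub _ R^o) //; first by tauto.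
- by apply: ideal_colon; case: pP.
- by case/idealP: (radIdeal_ideal I).
- by case/idealP: (radIdeal_ideal J).
Qed.

HB.instance Definition _ := GRing.Nmodule_isLSemiModule.Build (radIdeals R)
  radSubmods scaleA scale0 scale1 scaleDr scaleDl.

End RadicalSubmodules.

Section RadicalMap.
Variables (R : comPzRingType) (M M' : lmodType R) (f : {linear M -> M'}).

Definition radMap (N : radSubmods M) : radSubmods M' := radS (f @` N).

Lemma prime_preimage (P : set M') : prime_submodule P ->
  f @^-1` P <> setT -> prime_submodule (f @^-1` P).
Proof.
case=> sP PT pP fPT; split=> //.
  apply/submoduleP; split=> [|x y Px Py|r x Px] /=.
  - by rewrite linear0; apply: submodule0.
  - by rewrite linearD; apply: submoduleD.
  - by rewrite linearZ; apply: submoduleZ.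
move=> r m /=; rewrite linearZ => /pP[|rP]; [by left|right=> x].
by rewrite /= linearZ; apply: rP.
Qed.

Lemma image_rad_sub (A : set M) (P : set M') : prime_submodule P ->
  (f @` module_rad A `<=` P) <-> (f @` A `<=` P).
Proof.
move=> pP; rewrite !image_sub.
case: (lem (f @^-1` P = setT)) => [->|/(prime_preimage pP) pfP]; first by split.
exact: rad_sub.
Qed.

Lemma radMap_sub (N : radSubmods M) (P : set M') : prime_submodule P ->
  (radMap N `<=` P) <-> (f @` N `<=` P).
Proof. exact: rad_sub. Qed.

Let sub_preimage (P : set M') : prime_submodule P -> submodule (f @^-1` P).
Proof.
move=> pP; case: (lem (f @^-1` P = setT)) => [->|/(prime_preimage pP)[]//].
exact: submodule_setT.
Qed.

Lemma radMap_is_semilinear : semilinear radMap.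
Proof.
split=> [I N|N L]; apply: eq_radSubmods => P pP.
- have [sP _ _] := pP; rewrite radMap_sub // image_rad_sub // image_sub.
  rewrite mulset_sub; last exact: sub_preimage.
  rewrite radS_scale_sub // radMap_sub // -mulset_subP // mulset_sub //.
  split=> [h r _ Ir [x Nx <-]|h r x Ir Nx /=]; first by rewrite -linearZ; apply: h.
  by rewrite linearZ; apply: h => //; exists x.
- rewrite radMap_sub // image_rad_sub // image_sub.
  rewrite sumset_sub; [|exact: sub_preimage|exact: radSubmod0..].
  by rewrite radS_add_sub // !radMap_sub // !image_sub.
Qed.

HB.instance Definition _ := GRing.isSemilinear.Build (radIdeals R)
  (radSubmods M) (radSubmods M') *:%R radMap radMap_is_semilinear.

End RadicalMap.

Section Semimodules.
Variable S : pzSemiRingType.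

Section KernelImage.
Variables (U V : lSemiModType S) (f : {linear U -> V}).

Definition semi_ker : {pred U} := [pred x | f x == 0].
Definition semi_im : {pred V} := [pred y | `[< exists x, y = f x >]].

Lemma semi_ker_closed : subsemimod_closed semi_ker.
Proof.
split; first split=> [|x y].
- by rewrite inE linear0.
- by rewrite !inE linearD => /eqP-> /eqP->; rewrite addr0.
- by move=> a x; rewrite !inE linearZ /= => /eqP ->; rewrite scaler0.
Qed.

Lemma semi_im_closed : subsemimod_closed semi_im.
Proof.
split; first split=> [|_ _ /asboolP[x ->] /asboolP[y ->]].
- by apply/asboolP; exists 0; rewrite linear0.
- by apply/asboolP; exists (x + y); rewrite linearD.
- by move=> a _ /asboolP[x ->]; apply/asboolP; exists (a *: x); rewrite linearZ.
Qed.

HB.instance Definition _ := GRing.isSubSemiModClosed.Build S U semi_ker semi_ker_closed.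
HB.instance Definition _ := GRing.isSubSemiModClosed.Build S V semi_im semi_im_closed.

End KernelImage.

Section Subsemimodule.
Variables (U : lSemiModType S) (N : submodClosed U).

Record subsemimod := Subsemimod { subsemimod_val :> U; _ : subsemimod_val \in N }.

HB.instance Definition _ := [isSub for subsemimod_val].
HB.instance Definition _ := [Choice of subsemimod by <:].
HB.instance Definition _ := [SubChoice_isSubLSemiModule of subsemimod by <:].

End Subsemimodule.

Section Restrict.
Variables (U : lSemiModType S) (Z B : submodClosed U).

(* [B] as a subsemimodule of [Z]; no information is lost when [B] is contained
   in [Z]. *)
Definition restrict : {pred subsemimod Z} := [pred z | val z \in B].

Lemma restrict_closed : subsemimod_closed restrict.
Proof.
split; first split=> [|x y].
- by rewrite inE raddf0 rpred0.
- by rewrite !inE raddfD => xB yB; rewrite rpredD.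
- by move=> a x; rewrite !inE linearZ /= => xB; rewrite rpredZ.
Qed.

HB.instance Definition _ :=
  GRing.isSubSemiModClosed.Build S (subsemimod Z) restrict restrict_closed.

End Restrict.

Section Bourne.
Variables (U : lSemiModType S) (N : submodClosed U).

Definition bourne : rel U := fun m m' =>
  `[< exists n n', [/\ n \in N, n' \in N & m + n = m' + n'] >].

Lemma bourne_refl : reflexive bourne.
Proof. by move=> m; apply/asboolP; exists 0, 0; rewrite rpred0. Qed.

Lemma bourne_sym : symmetric bourne.
Proof.
by move=> m m'; apply/asboolP/asboolP => -[n [n' [? ? e]]]; exists n', n.
Qed.

Lemma bourne_trans : transitive bourne.
Proof.
move=> b a c /asboolP[n [n' [Nn Nn' ab]]] /asboolP[k [k' [Nk Nk' bc]]].
apply/asboolP; exists (n + k), (k' + n'); split; rewrite ?rpredD //.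
by rewrite addrA ab addrAC bc addrA.
Qed.

Canonical bourne_equiv := EquivRel bourne bourne_refl bourne_sym bourne_trans.

Definition bourne_quot := {eq_quot bourne_equiv}.

HB.instance Definition _ := Choice.on bourne_quot.
HB.instance Definition _ := EqQuotient.on bourne_quot.

Lemma bourneP (m m' : U) :
  reflect (exists n n', [/\ n \in N, n' \in N & m + n = m' + n'])
          (m == m' %[mod bourne_quot]).
Proof. by rewrite eqmodE; apply: asboolP. Qed.

Definition bq_add := lift_op2 bourne_quot +%R.
Definition bq_scale (a : S) := lift_op1 bourne_quot ( *:%R a).

Lemma pi_bq_add : {morph \pi_bourne_quot : x y / x + y >-> bq_add x y}.
Proof.
move=> x y; unlock bq_add; apply/eqP/bourneP.
have /bourneP[a [a' [Na Na' ea]]] : repr (\pi_bourne_quot x) == x %[mod bourne_quot].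
  by rewrite reprK.
have /bourneP[b [b' [Nb Nb' eb]]] : repr (\pi_bourne_quot y) == y %[mod bourne_quot].
  by rewrite reprK.
by exists (a' + b'), (a + b); rewrite !rpredD //; split=> //;
   rewrite !(addrACA _ _ a) !(addrACA _ _ a') ea eb.
Qed.

Lemma pi_bq_scale a : {morph \pi_bourne_quot : x / a *: x >-> bq_scale a x}.
Proof.
move=> x; unlock bq_scale; apply/eqP/bourneP.
have /bourneP[b [b' [Nb Nb' eb]]] : repr (\pi_bourne_quot x) == x %[mod bourne_quot].
  by rewrite reprK.
by exists (a *: b'), (a *: b); rewrite !rpredZ //; split=> //; rewrite -!scalerDr eb.
Qed.

Let addA : associative bq_add.
Proof.
elim/quotW=> x; elim/quotW=> y; elim/quotW=> z.
by rewrite -!pi_bq_add addrA.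
Qed.
Let addC : commutative bq_add.
Proof. by elim/quotW=> x; elim/quotW=> y; rewrite -!pi_bq_add addrC. Qed.
Let add0 : left_id (\pi_bourne_quot 0) bq_add.
Proof. by elim/quotW=> x; rewrite -!pi_bq_add add0r. Qed.

HB.instance Definition _ := GRing.isNmodule.Build bourne_quot addA addC add0.

Lemma pi_bourneD : {morph \pi_bourne_quot : x y / x + y}.
Proof. exact: pi_bq_add. Qed.

Let scaleA a b v : bq_scale a (bq_scale b v) = bq_scale (a * b) v.
Proof. by elim/quotW: v => x; rewrite -!pi_bq_scale scalerA. Qed.
Let scale0 v : bq_scale 0 v = 0.
Proof. by elim/quotW: v => x; rewrite -!pi_bq_scale scale0r. Qed.
Let scale1 : left_id 1 bq_scale.
Proof. by elim/quotW=> x; rewrite -!pi_bq_scale scale1r. Qed.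
Let scaleDr : right_distributive bq_scale +%R.
Proof.
move=> a; elim/quotW=> x; elim/quotW=> y.
by rewrite -pi_bourneD -!pi_bq_scale -pi_bourneD scalerDr.
Qed.
Let scaleDl v : {morph bq_scale^~ v : a b / a + b}.
Proof.
by elim/quotW: v => x a b; rewrite -!pi_bq_scale -pi_bourneD scalerDl.
Qed.

HB.instance Definition _ := GRing.Nmodule_isLSemiModule.Build S bourne_quot
  scaleA scale0 scale1 scaleDr scaleDl.

Lemma pi_bourneZ a : {morph \pi_bourne_quot : x / a *: x}.
Proof. exact: pi_bq_scale. Qed.

End Bourne.
End Semimodules.
Arguments restrict {S U} Z B _.

Section Complexes.
Variable R : comPzRingType.

(* [prev_mod M n] is [M_{n-1}], with [M_{-1} = 0], so that [prev_mod M n.+1]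
   reduces to [M n]. *)
Definition prev_mod (M : nat -> lmodType R) (n : nat) : lmodType R :=
  if n is m.+1 then M m else 'rV[R]_0.

Record complex := Complex {
  cmod :> nat -> lmodType R;
  cdiff : forall n, {linear cmod n -> prev_mod cmod n};
  cdiff_comp : forall n (x : cmod n.+1), cdiff n (cdiff n.+1 x) = 0
}.

Record cmap (X Y : complex) := Cmap {
  cmap_fun :> forall n, {linear X n -> Y n};
  cmap_comm : forall n (x : X n.+1),
    cdiff Y n.+1 (cmap_fun n.+1 x) = cmap_fun n (cdiff X n.+1 x)
}.

Definition cmap_id (X : complex) : cmap X X :=
  @Cmap X X (fun n => idfun) (fun n x => erefl).

Lemma cmap_comp_comm (X Y Z : complex) (psi : cmap Y Z) (phi : cmap X Y) n
    (x : X n.+1) :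
  cdiff Z n.+1 ((psi n.+1 \o phi n.+1) x) = (psi n \o phi n) (cdiff X n.+1 x).
Proof. by rewrite /= !cmap_comm. Qed.

Definition cmap_comp (X Y Z : complex) (psi : cmap Y Z) (phi : cmap X Y) :
  cmap X Z := Cmap (cmap_comp_comm psi phi).

Variable X : complex.

Definition radDiff n : {linear radSubmods (X n) -> radSubmods (prev_mod X n)} :=
  radMap (cdiff X n).

Lemma radDiff_comp n (N : radSubmods (X n.+1)) :
  radDiff n (radDiff n.+1 N) = 0.
Proof.
apply: eq_radSubmods => P pP; rewrite radMap_sub // image_rad_sub //.
split=> _; first exact: radS0_sub.
by move=> _ [_ [x _ <-] <-]; rewrite cdiff_comp; apply: submodule0; case: pP.
Qed.

Definition cycles n : submodClosed (radSubmods (X n)) := semi_ker (radDiff n).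

Definition boundaries n : submodClosed (radSubmods (X n)) :=
  semi_im (radDiff n.+1).

Lemma boundaries_sub_cycles n : {subset boundaries n <= cycles n}.
Proof. by move=> _ /asboolP[N ->]; apply/eqP/radDiff_comp. Qed.

Definition homology n : lSemiModType (radIdeals R) :=
  bourne_quot (restrict (cycles n) (boundaries n)).

Definition hclass n (N : radSubmods (X n)) (ZN : N \in cycles n) : homology n :=
  \pi_(bourne_quot (restrict (cycles n) (boundaries n))) (Subsemimod ZN).

End Complexes.

(* Main.v *)
(** Radicals satisfy [rad (g (rad A)) = rad (g A)] for a linear map [g], so
    [N |-> rad (f N)] is functorial in [f].  A map of complexes therefore
    commutes with the induced differentials, sends cycles to cycles and
    boundaries to boundaries, and descends to the Bourne quotients; the
    functoriality of homology is then checked on representatives. *)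
Require Import Defs.
From HB Require Import structures.
From mathcomp Require Import all_boot all_order all_algebra.
From mathcomp Require Import generic_quotient.
From mathcomp Require Import boolp classical_sets.

Set Implicit Arguments.
Unset Strict Implicit.
Unset Printing Implicit Defensive.

Import GRing.Theory.
Local Open Scope classical_set_scope.
Local Open Scope ring_scope.
Local Open Scope quotient_scope.

Section RadMapFunctor.
Variable R : comPzRingType.

Lemma eq_radMap (M M' : lmodType R) (f g : {linear M -> M'}) :
  f =1 g -> radMap f =1 radMap g.
(* [fg] equates only the underlying functions, which is all that the image sees. *)
Proof. by move=> /funext fg N; rewrite /radMap fg. Qed.

Lemma radMap_idfun (M : lmodType R) (N : radSubmods M) :
  radMap (idfun : {linear M -> M}) N = N.
Proof.
by apply: eq_radSubmods => P pP; rewrite radMap_sub // image_id.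
Qed.

Lemma radMap_comp (M M' M'' : lmodType R) (g : {linear M' -> M''})
    (f : {linear M -> M'}) (N : radSubmods M) :
  radMap g (radMap f N) = radMap (g \o f) N.
Proof.
apply: eq_radSubmods => P pP.
by rewrite !radMap_sub // image_rad_sub // image_comp.
Qed.

Lemma radMap_square (M M' L L' : lmodType R) (f : {linear M -> M'})
    (g : {linear M' -> L'}) (h : {linear M -> L}) (k : {linear L -> L'}) :
  (forall x, g (f x) = k (h x)) ->
  forall N : radSubmods M, radMap g (radMap f N) = radMap k (radMap h N).
Proof. by move=> gfkh N; rewrite !radMap_comp; apply: eq_radMap. Qed.

(** A zero module has no proper submodule, hence no prime one, so the comparison over primes is
    vacuous. This settles degree 0, where the differential lands in $M_{-1}=0$. *)
Lemma radSubmods_trivial (M : lmodType R) :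
  (forall x : M, x = 0) -> forall N L : radSubmods M, N = L.
Proof.
move=> M0 N L; apply: eq_radSubmods => P [sP PT _]; case: PT.
by apply/seteqP; split=> // x _; rewrite (M0 x); apply: submodule0.
Qed.

End RadMapFunctor.

Section SubsemimodMap.
Variables (S : pzSemiRingType) (U V : lSemiModType S).
Variables (Z : submodClosed U) (Z' : submodClosed V) (f : {linear U -> V}).
Hypothesis fZ : {homo f : x / x \in Z >-> x \in Z'}.

Definition subsemimod_map (z : subsemimod Z) : subsemimod Z' :=
  Subsemimod (fZ (valP z)).

Lemma subsemimod_map_is_semilinear : semilinear subsemimod_map.
Proof.
split=> [a x|x y]; apply: val_inj; first by rewrite /= !linearZ.
by rewrite /= !raddfD.
Qed.

HB.instance Definition _ := GRing.isSemilinear.Build S (subsemimod Z)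
  (subsemimod Z') *:%R subsemimod_map subsemimod_map_is_semilinear.

End SubsemimodMap.

Section BourneMap.
Variables (S : pzSemiRingType) (U V : lSemiModType S).
Variables (N : submodClosed U) (N' : submodClosed V) (f : {linear U -> V}).
Hypothesis fN : {homo f : x / x \in N >-> x \in N'}.

(* The linear structure, found from [bourne_map] alone, needs [fN]. *)
#[using="fN"]
Definition bourne_map (c : bourne_quot N) : bourne_quot N' :=
  \pi_(bourne_quot N') (f (repr c)).

(** Independence of the representative: if [repr] and [x] agree after adding [a] and [b] from [N],
    their images agree after adding [f a] and [f b], which lie in [N']. *)
Lemma bourne_map_pi (x : U) :
  bourne_map (\pi_(bourne_quot N) x) = \pi_(bourne_quot N') (f x).
Proof.
have /bourneP[a [b [Na Nb e]]] :
  repr (\pi_(bourne_quot N) x) == x %[mod bourne_quot N] by rewrite reprK.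
by apply/eqP/bourneP; exists (f a), (f b); rewrite -!linearD e !fN.
Qed.

Lemma bourne_map_is_semilinear : semilinear bourne_map.
Proof.
split=> [a|]; first elim/quotW=> x.
  by rewrite -pi_bourneZ !bourne_map_pi linearZ pi_bourneZ.
elim/quotW=> x; elim/quotW=> y.
by rewrite -pi_bourneD !bourne_map_pi linearD pi_bourneD.
Qed.

HB.instance Definition _ := GRing.isSemilinear.Build S (bourne_quot N)
  (bourne_quot N') *:%R bourne_map bourne_map_is_semilinear.

End BourneMap.

Section HomologyMap.
Variables (R : comPzRingType) (X Y : complex R) (phi : cmap X Y).

Lemma radMap_cdiff n (N : radSubmods (X n.+1)) :
  radDiff Y n.+1 (radMap (phi n.+1) N) = radMap (phi n) (radDiff X n.+1 N).
Proof.
(* The modules are given explicitly because [prev_mod X n.+1] is [X n] only up to reduction. *)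
apply: (@radMap_square R (X n.+1) (Y n.+1) (X n) (Y n)) => x.
exact: cmap_comm.
Qed.

Lemma radMap_cycles n :
  {homo radMap (phi n) : N / N \in cycles X n >-> N \in cycles Y n}.
Proof.
case: n => [N _|n N /eqP ZN]; apply/eqP.
  (* In degree 0 the target is ['rV[R]_0], whose vectors have no entries. *)
  by apply: radSubmods_trivial => x; apply/rowP => -[].
by rewrite radMap_cdiff ZN linear0.
Qed.

Lemma radMap_boundaries n :
  {homo radMap (phi n) : N / N \in boundaries X n >-> N \in boundaries Y n}.
Proof.
move=> _ /asboolP[L ->]; apply/asboolP.
by exists (radMap (phi n.+1) L); rewrite radMap_cdiff.
Qed.

Definition cycle_map n : {linear subsemimod (cycles X n) -> subsemimod (cycles Y n)} :=
  subsemimod_map (@radMap_cycles n).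

Lemma cycle_map_boundaries n :
  {homo cycle_map n : z / z \in restrict (cycles X n) (boundaries X n)
                      >-> z \in restrict (cycles Y n) (boundaries Y n)}.
Proof. by move=> z; apply: radMap_boundaries. Qed.

Definition homology_map n : {linear homology X n -> homology Y n} :=
  bourne_map (@cycle_map_boundaries n).

Lemma homology_mapE n (N : radSubmods (X n)) (ZN : N \in cycles X n) :
  homology_map n (hclass ZN) = hclass (radMap_cycles ZN).
Proof.
apply: etrans (bourne_map_pi (@cycle_map_boundaries n) (Subsemimod ZN)) _.
by congr (\pi_ _ _); apply: val_inj.
Qed.

End HomologyMap.

Section HomologyClass.
Variables (R : comPzRingType) (X : complex R) (n : nat).

Lemma hclassW (P : homology X n -> Prop) :
  (forall (N : radSubmods (X n)) (ZN : N \in cycles X n), P (hclass ZN)) ->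
  forall c, P c.
Proof. by move=> PH; elim/quotW=> -[N ZN]; apply: PH. Qed.

(** A class carries a proof that its representative is a cycle; this allows the representative to be
    replaced without transporting that proof. *)
Lemma eq_hclass (N L : radSubmods (X n)) (ZN : N \in cycles X n)
    (ZL : L \in cycles X n) : N = L -> hclass ZN = hclass ZL.
Proof. by move=> NL; congr (\pi_ _ _); apply: val_inj. Qed.

End HomologyClass.

Theorem theorem1 (R : comPzRingType) :
  exists H : forall (M M' : complex R) (phi : cmap M M') (n : nat),
      {linear homology M n -> homology M' n},
    [/\ forall (M M' : complex R) (phi : cmap M M') (n : nat)
          (N : radSubmods (M n)) (ZN : N \in cycles M n),
          exists ZN' : radMap (phi n) N \in cycles M' n,
            H M M' phi n (hclass ZN) = hclass ZN' /\
            (radMap (phi n) N : set (M' n)) = module_rad (phi n @` N),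
        forall (M : complex R) (n : nat) (c : homology M n),
          H M M (cmap_id M) n c = c
      & forall (M M' M'' : complex R) (phi : cmap M M') (psi : cmap M' M'')
          (n : nat) (c : homology M n),
          H M' M'' psi n (H M M' phi n c) = H M M'' (cmap_comp psi phi) n c].
Proof.
exists (@homology_map R); split=> [M M' phi n N ZN|M n|M M' M'' phi psi n].
(* The formula with [module_rad] holds by definition of [radMap]. *)
- by exists (radMap_cycles phi ZN); rewrite homology_mapE.
- elim/hclassW=> N ZN; rewrite homology_mapE; apply: eq_hclass.
  exact: radMap_idfun.
- elim/hclassW=> N ZN; rewrite !homology_mapE; apply: eq_hclass.
  exact: radMap_comp.
Qed.
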